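(* Let $d\ge 2$ and $1\le k\le d-1$ be integers. Then there is a constant $C>0$, depending only on $d$ and $k$ (in particular independent of $q$ and of the functions $f_j$), such that for every finite field $\mathbb F_q$ with $q$ elements and all functions $f_1,f_2,\dots,f_{d+1}:\mathbb F_q^d\to\mathbb C$, $$\Big\|\prod_{j=1}^{d+1}T_kf_j\Big\|_{L^1(M_k,d\lambda_k)}\le C\prod_{j=1}^{d+1}\|f_j\|_{L^{\frac{d+1}{k+1}}(\mathbb F_q^d,d\mathbf x)},$$ where $T_k$ is the $k$-plane transform on $\mathbb F_q^d$.
   Context: $\mathbb F_q$ is a finite field with $q$ elements and $\mathbb F_q^d$ is the $d$-dimensional vector space over it, equipped with the normalized counting measure $d\mathbf x$, so that for $1\le p<\infty$ $$\|f\|_{L^p(\mathbb F_q^d,d\mathbf x)}=\Big(q^{-d}\sum_{\mathbf x\in\mathbb F_q^d}|f(\mathbf x)|^p\Big)^{1/p}.$$ A $k$-plane is a $k$-dimensional affine subspace of $\mathbb F_q^d$, and $M_k$ is the set of all $k$-planes in $\mathbb F_q^d$. The set $M_k$ is equipped with the normalized counting measure $\lambda_k$, so that for $g:M_k\to\mathbb C$ and $1\le r<\infty$ $$\|g\|_{L^r(M_k,d\lambda_k)}=\Big(\frac1{|M_k|}\sum_{\omega\in M_k}|g(\omega)|^r\Big)^{1/r},$$ where $|\cdot|$ of a finite set denotes its cardinality. The $k$-plane transform of $f:\mathbb F_q^d\to\mathbb C$ is the function $T_kf:M_k\to\mathbb C$ given by $$T_kf(\omega)=\frac1{|\omega|}\sum_{\mathbf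 x\in\omega}f(\mathbf x),\qquad \omega\in M_k,$$ where $|\omega|=q^k$. The product $\prod_{j=1}^{d+1}T_kf_j$ is the pointwise product of functions on $M_k$. *)

(* Defs.v *)
From HB Require Import structures.
From mathcomp Require Import all_boot all_order all_algebra.
From mathcomp Require Import boolp reals exp.
From mathcomp Require Import complex.

Set Implicit Arguments.
Unset Strict Implicit.
Unset Printing Implicit Defensive.

Import Order.TTheory GRing.Theory Num.Theory.
Local Open Scope ring_scope.

(* The modulus is [ComplexField.Normc.normc : R[i] -> R], because [`|z|] on
   [R[i]] is itself an element of [R[i]] while [powR] expects a real base. *)
Definition normalized_Lp_norm (R : realType) (T : finType) (p : R)
    (f : T -> R[i]) : R :=
  (#|T|%:R^-1 * \sum_(x : T) ComplexField.Normc.normc (f x) `^ p) `^ p^-1.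

Definition is_kplane (F : finFieldType) (d k : nat) (w : {set 'rV[F]_d}) : Prop :=
  exists (a : 'rV[F]_d) (V : {vspace 'rV[F]_d}),
    \dim V = k /\ w = [set a + v | v in V].

Definition kplane (F : finFieldType) (d k : nat) : Type :=
  {w : {set 'rV[F]_d} | `[< is_kplane k w >]}.

HB.instance Definition _ (F : finFieldType) (d k : nat) :=
  Finite.on (kplane F d k).

Definition kplane_transform (R : realType) (F : finFieldType) (d k : nat)
    (f : 'rV[F]_d -> R[i]) (w : kplane F d k) : R[i] :=
  #|val w|%:R^-1 * \sum_(x in val w) f x.

(* Main.v *)
Require Import Defs.
From HB Require Import structures.
From mathcomp Require Import all_boot all_order all_algebra.
From mathcomp Require Import mxabelem.
From mathcomp Require Import boolp reals exp.
From mathcomp Require Import complex.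
From mathcomp Require Import ring lra zify.

Set Implicit Arguments.
Unset Strict Implicit.
Unset Printing Implicit Defensive.

Import Order.TTheory GRing.Theory Num.Theory.
Local Open Scope ring_scope.

(* After normalising each f_j, the product of the T_k f_j is at most the sum of
   the (d+1)-st powers, so only sum_w (T_k f(w))^(d+1) has to be bounded, for one
   f >= 0 with sum f^p <= q^d, p = (d+1)/(k+1). Averages over k-planes are averages
   over affine frames A of F^d, the plane of A being the image of the points
   aff_lift y, y in F^k; dropping the invertibility of A costs a factor 2^d.

   Expand the power over tuples c_0, .., c_d in F^k, with x_i = aff_lift c_i * A.
   A greedy basis, built in order of decreasing f, splits the indices into an
   independent set I and dependent indices j, each in the affine span of a set
   J_j of elements of I with f(x_j) <= f(x_i) for i in J_j. With
   delta = (p - 1) / (d + 1 - |I|) one moves a power f(x_j)^delta from each j to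
   each i in J_j. The exponent at i in I becomes at most p, so averaging over A,
   under which the x_i (i in I) are independent and uniform, costs O(1). The
   exponent at j becomes a = 1 - |J_j| delta, and as c_j ranges over a flat of at
   most q^(r-1) points, r = |J_j|, the sum over c_j is at most
   2 q^(r-1 + (d+1-r) a/p) <= 2 q^k. *)

(** * Affine points as rows: counting on flats, independence, greedy bases *)

(** Homogeneous coordinates: for [k <= d], [y] is padded with zeros to length [d] and preceded by 1.
    Affine dependence of points becomes linear dependence of rows, and a frame [A] acts as the
    affine map with translation [usubmx A] and linear part [dsubmx A]. *)
Definition aff_lift (F : finFieldType) (d k : nat) (y : 'rV[F]_k) : 'rV[F]_(1 + d) :=
  row_mx 1%:M (y *m pid_mx k).

Lemma aff_lift_inj (F : finFieldType) (d k : nat) :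
  (k <= d)%N -> injective (@aff_lift F d k).
Proof.
move=> kd y z /eq_row_mx[_] /(congr1 (fun x => x *m (pid_mx k : 'M_(d, k)))) /=.
by rewrite -!mulmxA !mul_pid_mx minnn (minn_idPr kd) pid_mx_1 !mulmx1.
Qed.

(** Scaling one lifted point by [a] and adding differences of lifts embeds pairs [(a, y)] in the row
    space of [W]: the first coordinate recovers [a], the rest then recovers [y]. The factor [#|F|]
    on the left replaces an exponent [\rank W - 1]. *)
Lemma card_flat (F : finFieldType) (d k m : nat) (W : 'M[F]_(m, 1 + d)) :
  (k <= d)%N ->
  (#|F| * #|[set y : 'rV[F]_k | (aff_lift d y <= W)%MS]| <= #|F| ^ \rank W)%N.
Proof.
move=> kd; set Y := [set y | _].
have [->|[y0]] := set_0Vmem Y; first by rewrite cards0 muln0.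
rewrite inE => y0W.
pose phi (u : F * 'rV[F]_k) := u.1 *: aff_lift d y0 + (aff_lift d u.2 - aff_lift d y0).
rewrite -card_rowg -cardsT -cardsX -(card_imset (f := phi)).
  apply/subset_leq_card/subsetP=> w /imsetP[[a y]] /setXP[_ /=]; rewrite inE => yW ->.
  by rewrite mem_rowg /phi /= addmx_sub ?scalemx_sub // addmx_sub // -scaleN1r scalemx_sub.
have lE y : lsubmx (aff_lift d y) = 1%:M :> 'M[F]_1 by rewrite row_mxKl.
move=> [a y] [b z]; rewrite /phi /= => e.
have ab : a = b.
  move: (congr1 lsubmx e); rewrite !linearD /= !linearN /= !linearZ /= !lE subrr !addr0.
  by move/matrixP/(_ 0 0); rewrite !mxE !mulr1.
by move: e; rewrite ab => /addrI/addIr/(aff_lift_inj kd) ->.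
Qed.

(** Since [D] has a right inverse, [B |-> D *m B] is onto and its fibres are translates of the
    kernel; counting all matrices [B] gives their common size. *)
Lemma sum_mulmx_row_free (R : nzRingType) (F : finFieldType) (m n d : nat)
    (D : 'M[F]_(m, n)) (G : 'M[F]_(m, d) -> R) :
  row_free D ->
  \sum_(B : 'M[F]_(n, d)) G (D *m B) =
    (#|F| ^ ((n - m) * d))%:R * \sum_(Y : 'M[F]_(m, d)) G Y.
Proof.
move=> Dfree; have [D' DD'] := row_freeP Dfree.
have mn : (m <= n)%N by rewrite -(eqP Dfree) rank_leq_col.
pose K := #|[set B : 'M[F]_(n, d) | D *m B == 0]|.
have fibre Y : #|[set B : 'M[F]_(n, d) | D *m B == Y]| = K.
  rewrite /K -[RHS](card_imset _ (addrI (D' *m Y))); apply: eq_card => B.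
  rewrite inE; apply/eqP/imsetP => [DB|[B0]]; last first.
    by rewrite inE => /eqP DB0 ->; rewrite mulmxDr DB0 addr0 mulmxA DD' mul1mx.
  exists (B - D' *m Y); last by rewrite addrC subrK.
  by rewrite inE mulmxBr DB mulmxA DD' mul1mx subrr.
have KE : K = (#|F| ^ ((n - m) * d))%N.
  apply/eqP; rewrite -(eqn_pmul2r (m := #|F| ^ (m * d))); last first.
    by rewrite expn_gt0; apply/orP; left; apply/card_gt0P; exists 0.
  rewrite -expnD -mulnDl subnK // -!card_mx mulnC -sum_nat_const; apply/eqP.
  rewrite -sum1_card (partition_big (fun B : 'M[F]_(n, d) => D *m B) predT) //=.
  apply: eq_bigr => Y _; rewrite sum1dep_card -(fibre Y).
  by apply/eq_card => B; rewrite inE.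
rewrite (partition_big (fun B : 'M[F]_(n, d) => D *m B) predT) //= mulr_sumr.
apply: eq_bigr => Y _; rewrite (eq_bigr (fun=> G Y)) => [|B /eqP -> //].
rewrite -KE -(fibre Y) mulr_natl sumr_const; congr (_ *+ _).
by apply: eq_card => B; rewrite inE.
Qed.

Lemma sum_prod_row (R : comNzRingType) (F : finFieldType) (m d : nat)
    (g : 'I_m -> 'rV[F]_d -> R) :
  \sum_(Y : 'M[F]_(m, d)) \prod_i g i (row i Y) = \prod_i \sum_x g i x.
Proof.
rewrite bigA_distr_bigA.
rewrite (reindex (fun Y : 'M[F]_(m, d) => [ffun i => row i Y])) /=.
  by apply: eq_bigr => Y _; apply: eq_bigr => i _; rewrite ffunE.
exists (fun c : {ffun 'I_m -> 'rV[F]_d} => \matrix_i c i) => [Y _|c _].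
  by apply/row_matrixP => i; rewrite rowK ffunE.
by apply/ffunP => i; rewrite ffunE rowK.
Qed.

(** Linear independence of the rows [e i] becomes independence in the probabilistic sense: for
    uniform [A] the vectors [e i *m A] are independent and uniform. *)
Lemma sum_prod_free (R : comNzRingType) (F : finFieldType) (T : finType) (n d : nat)
    (I : {set T}) (e : T -> 'rV[F]_n) (g : T -> 'rV[F]_d -> R) :
  (#|I| <= \rank (\sum_(i in I) <<e i>>)%MS)%N ->
  \sum_(A : 'M[F]_(n, d)) \prod_(i in I) g i (e i *m A) =
    (#|F| ^ ((n - #|I|) * d))%:R * \prod_(i in I) \sum_x g i x.
Proof.
move=> Ifree; pose D := \matrix_(a < #|I|) e (enum_val a).
have Dfree : row_free D.
  rewrite /row_free eqn_leq rank_leq_row (leq_trans Ifree) // mxrankS //.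
  apply/sumsmx_subP => i iI; rewrite genmxE; apply: (eq_row_sub (enum_rank_in iI i)).
  by rewrite rowK enum_rankK_in.
have := sum_mulmx_row_free
  (fun Y : 'M[F]_(#|I|, d) => \prod_a g (enum_val a) (row a Y)) Dfree.
rewrite (sum_prod_row (fun a => g (enum_val a))) -(big_enum_val (fun i => \sum_x g i x)) /= => <-.
apply: eq_bigr => A _; rewrite big_enum_val /=.
by apply: eq_bigr => a _; rewrite row_mul rowK.
Qed.

(* [J j] collects the members of the greedy basis [I] chosen before [j], when
   the points are taken in order of decreasing [u]. *)
Lemma greedy_basis (R : realDomainType) (F : fieldType) (T : finType) (n : nat)
    (e : T -> 'rV[F]_n) (u : T -> R) (E : {set T}) :
  exists (I : {set T}) (J : {ffun T -> {set T}}),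
    [/\ I \subset E, (#|I| <= \rank (\sum_(i in I) <<e i>>)%MS)%N
      & {in E :\: I, forall j, [/\ J j \subset I, (e j <= \sum_(i in J j) <<e i>>)%MS
          & {in J j, forall i, u j <= u i}]}].
Proof.
have [N] := ubnP #|E|; elim: N E => // N IH E EN.
have [->|[x0 x0E]] := set_0Vmem E.
  exists set0, [ffun=> set0]; split; rewrite ?sub0set ?cards0 //.
  by move=> j; rewrite setD0 inE.
pose x := [arg min_(i < x0 in E) u i]%O.
have [xE xmin] : x \in E /\ {in E, forall i, u x <= u i}.
  by rewrite /x; case: arg_minP => // i iE im; split.
have [|I [J [IE Ifree IJ]]] := IH (E :\ x).
  by rewrite (cardsD1 x) xE in EN.
have xI : x \notin I by apply: contraTN xE => /(subsetP IE); rewrite !inE eqxx.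
have IE' : I \subset E by rewrite (subset_trans IE) ?subD1set.
have [xs|xs] := boolP (e x <= \sum_(i in I) <<e i>>)%MS.
  exists I, [ffun j => if j == x then I else J j]; split=> // j.
  rewrite !inE ffunE => /andP[jI jE]; case: eqVneq => [->|jx].
    by split=> // i /(subsetP IE'); apply: xmin.
  by apply: IJ; rewrite !inE jI jx.
exists (x |: I), J; split.
- by rewrite subUset sub1set xE.
- rewrite cardsU1 xI add1n big_setU1 //=; apply: leq_ltn_trans Ifree _.
  suff: (\sum_(i in I) <<e i>> < <<e x>> + \sum_(i in I) <<e i>>)%MS.
    by rewrite ltmxErank => /andP[].
  by rewrite ltmxE addsmxSr addsmx_sub submx_refl andbT genmxE.
- move=> j; rewrite !inE negb_or -andbA => /and3P[jx jI jE].
  have [|Js eJ uJ] := IJ j; first by rewrite !inE jI jx jE.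
  by split=> //; apply: subset_trans Js (subsetUr _ _).
Qed.

(** * Splitting powers and moving them between factors *)

Lemma ler_sum_subpred (R : numDomainType) (T : finType) (P Q : pred T) (F : T -> R) :
  (forall i, P i -> Q i) -> (forall i, 0 <= F i) ->
  \sum_(i | P i) F i <= \sum_(i | Q i) F i.
Proof.
move=> PQ F0; rewrite [leRHS](bigID P) /=.
rewrite (eq_bigl P) => [|i]; last by rewrite andb_idl //; apply: PQ.
by rewrite lerDl sumr_ge0.
Qed.

(** Below the threshold [t] the first term suffices; above it the second does, as the exponent
    [a - p] is not positive. *)
Lemma powR_le_split (R : realType) (a p t x : R) :
  0 < t -> 0 <= x -> 0 <= a <= p -> x `^ a <= t `^ a + t `^ (a - p) * x `^ p.
Proof.
move=> t0 x0 /andP[a0 ap]; have [xt|tx] := leP x t.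
  apply: (le_trans (ge0_ler_powR a0 _ _ xt)); rewrite ?nnegrE ?(ltW t0) //.
  by rewrite lerDl mulr_ge0 ?powR_ge0.
have x_gt0 := lt_trans t0 tx.
have -> : x `^ a = x `^ (a - p) * x `^ p.
  by rewrite -powRD ?subrK // (gt_eqF x_gt0) implybT.
apply: le_trans (_ : t `^ (a - p) * x `^ p <= _); last by rewrite lerDr powR_ge0.
rewrite ler_wpM2r ?powR_ge0 // -[a - p]opprB !powRN lef_pV2 ?posrE ?powR_gt0 //.
by apply: ge0_ler_powR; rewrite ?nnegrE ?subr_ge0 // ltW.
Qed.

(** Each [g j] off [I] gives up [g j ^ delta] once for every [i] in [J j], where it is replaced by
    the larger [g i ^ delta]; the cardinals in the exponents count what is given and received. *)
Lemma prod_le_transfer (R : realType) (T : finType) (I : {set T}) (J : T -> {set T})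
    (g : T -> R) (delta : R) :
  0 <= delta -> (forall i, 0 <= g i) ->
  (forall j, j \notin I ->
     [/\ J j \subset I, #|J j|%:R * delta <= 1 & {in J j, forall i, g j <= g i}]) ->
  \prod_i g i <=
    (\prod_(i in I) g i `^ (1 + #|[set j | (j \notin I) && (i \in J j)]|%:R * delta)) *
    \prod_(j | j \notin I) g j `^ (1 - #|J j|%:R * delta).
Proof.
move=> d0 g0 IJ; rewrite (bigID (mem I)) /=.
have powE i (S : {set T}) : g i `^ (#|S|%:R * delta) = \prod_(j in S) g i `^ delta.
  by rewrite prodr_const mulrC powRrM powR_mulrn ?powR_ge0.
rewrite [X in _ <= X * _](eq_bigr (fun i => g i *
    \prod_(j | (j \notin I) && (i \in J j)) g i `^ delta)); last first.
  (* The total exponent is at least 1, hence nonzero, so the addition law for powers holds also at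
     [g i = 0]. *)
  move=> i _; rewrite powRD; last by rewrite gt_eqF // ltr_pwDl // mulr_ge0 ?ler0n.
  rewrite powRr1 // powE.
  by congr (_ * _); apply: eq_bigl => j; rewrite inE.
rewrite big_split /= -mulrA ler_wpM2l ?prodr_ge0 //.
rewrite (exchange_big_dep (fun j => j \notin I)) /=; last by move=> i j _ /andP[].
rewrite -big_split /=; apply: ler_prod => j jI; rewrite g0 /=.
have [JI r1 gJ] := IJ j jI.
have -> : \prod_(i in I | (j \notin I) && (i \in J j)) g i `^ delta =
          \prod_(i in J j) g i `^ delta.
  by apply: eq_bigl => i; rewrite jI /= andb_idl // => /(subsetP JI).
rewrite -{1}[g j]powRr1 // -{1}(subrKC (#|J j|%:R * delta) 1) powRD; last first.
  by rewrite subrKC oner_eq0.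
rewrite ler_wpM2r ?powR_ge0 // powE; apply: ler_prod => i iJ.
by rewrite powR_ge0 ge0_ler_powR ?nnegrE // gJ.
Qed.

(** * Sums over flats and the contribution of one dependence pattern *)

Lemma flat_sum_le (R : realType) (F : finFieldType) (d k m r : nat) (a p : R)
    (f : 'rV[F]_d -> R) (A : 'M[F]_(1 + d, d)) (W : 'M[F]_(m, 1 + d)) :
  (k <= d)%N -> 0 < p -> 0 <= a <= p -> (\rank W <= r)%N ->
  r%:R - 1 + (d.+1%:R - r%:R) * a / p <= k%:R ->
  (forall x, 0 <= f x) -> \sum_x f x `^ p <= (#|F| ^ d)%:R ->
  injective (fun y : 'rV[F]_k => aff_lift d y *m A) ->
  \sum_(y : 'rV[F]_k | (aff_lift d y <= W)%MS) f (aff_lift d y *m A) `^ a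
    <= 2%:R * (#|F| ^ k)%:R.
Proof.
move=> kd p0 ap rW expo f0 fp Ainj; set q : R := #|F|%:R.
have q1 : 1 <= q by rewrite /q ler1n; apply/card_gt0P; exists 0.
have q0 : 0 < q by apply: lt_le_trans q1.
have qX m' : (#|F| ^ m')%:R = q `^ m'%:R by rewrite natrX powR_mulrn // ltW.
have qD (x y : R) : q `^ (x + y) = q `^ x * q `^ y.
  by rewrite powRD // (gt_eqF q0) implybT.
(* This threshold balances the two terms: at most q^(r-1) points of the flat give t^a each, the sum
   of f^p is at most q^d, and both products reach the exponent bounded in [expo]. *)
set t := q `^ ((d.+1%:R - r%:R) / p).
have t0 : 0 < t by rewrite powR_gt0.
apply: (le_trans (ler_sum _ (fun y _ => powR_le_split t0 (f0 (aff_lift d y *m A)) ap))).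
rewrite big_split /= -mulr_sumr mulr2n mulrDl mul1r lerD //.
- have flat : #|[set y : 'rV[F]_k | (aff_lift d y <= W)%MS]|%:R <= q `^ (r%:R - 1).
    rewrite powRD ?(gt_eqF q0) ?implybT // powRN powRr1 ?(ltW q0) //.
    rewrite ler_pdivlMr // mulrC -qX -natrM ler_nat (leq_trans (card_flat W kd)) //.
    by rewrite leq_pexp2l //; apply/card_gt0P; exists 0.
  rewrite sumr_const -[_ *+ _]mulr_natl -[X in X%:R * _]cardsE.
  apply: (le_trans (ler_wpM2r (powR_ge0 _ _) flat)).
  by rewrite /t -powRrM -qD qX ler_powR //; apply: le_trans expo; rewrite mulrAC.
- have sub : \sum_(y : 'rV[F]_k | (aff_lift d y <= W)%MS) f (aff_lift d y *m A) `^ p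
             <= q `^ d%:R.
    rewrite -qX; apply: le_trans fp.
    pose S := [set y : 'rV[F]_k | (aff_lift d y <= W)%MS].
    rewrite (eq_bigl (fun y => y \in S)) => [|y]; last by rewrite inE.
    rewrite -(big_imset (fun x => f x `^ p) (h := fun y => aff_lift d y *m A)).
      by apply: ler_sum_subpred => // x; rewrite powR_ge0.
    by move=> y z _ _ /Ainj.
  apply: (le_trans (ler_wpM2l (powR_ge0 _ _) sub)).
  rewrite /t -powRrM -qD qX ler_powR //; apply: le_trans expo.
  rewrite le_eqVlt; apply/orP; left; apply/eqP.
  by rewrite -[d.+1]addn1 natrD; field; rewrite gt_eqF.
Qed.

Definition aff_span (F : finFieldType) (d k : nat) (T : finType) (S : {set T})
    (c : T -> 'rV[F]_k) : 'M[F]_(1 + d) :=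
  (\sum_(i in S) <<aff_lift d (c i)>>)%MS.

Lemma aff_span_rank (F : finFieldType) (d k : nat) (T : finType) (S : {set T})
    (c : T -> 'rV[F]_k) :
  (\rank (aff_span d S c) <= #|S|)%N.
Proof.
pose D := \matrix_(a < #|S|) aff_lift d (c (enum_val a)).
apply: leq_trans (mxrankS _) (rank_leq_row D).
apply/sumsmx_subP => i iS; rewrite genmxE; apply: (eq_row_sub (enum_rank_in iS i)).
by rewrite rowK enum_rankK_in.
Qed.

(** Lifts from F^k use only the first [k + 1] coordinates, so they lie in the row space of [H]. This
    limits an independent set of lifts to [k + 1] members. *)
Lemma aff_span_rank_dim (F : finFieldType) (d k : nat) (T : finType) (S : {set T})
    (c : T -> 'rV[F]_k) :
  (\rank (aff_span d S c) <= k.+1)%N.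
Proof.
pose H : 'M[F]_(1 + k, 1 + d) := block_mx 1%:M 0 0 (pid_mx k).
apply: leq_trans (mxrankS _) (rank_leq_row H).
apply/sumsmx_subP => i iS; rewrite genmxE; apply/submxP.
by exists (row_mx 1%:M (c i)); rewrite mul_row_block mul1mx !mulmx0 addr0 add0r.
Qed.

Lemma aff_lift_mulE (F : finFieldType) (d k : nat) (A : 'M[F]_(1 + d, d)) (y : 'rV[F]_k) :
  aff_lift d y *m A = usubmx A + y *m pid_mx k *m dsubmx A.
Proof. by rewrite -{1}[A]vsubmxK mul_row_col mul1mx. Qed.

Lemma aff_lift_mul_inj (F : finFieldType) (d k : nat) (A : 'M[F]_(1 + d, d)) :
  (k <= d)%N -> dsubmx A \in unitmx ->
  injective (fun y : 'rV[F]_k => aff_lift d y *m A).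
Proof.
move=> kd Au y z; rewrite !aff_lift_mulE => /addrI /(congr1 (mulmx^~ (invmx (dsubmx A)))) /=.
rewrite !mulmxK // => yz; apply: (@aff_lift_inj _ d) => //.
by rewrite /aff_lift yz.
Qed.

(* [P.1] is the basis [I] of [greedy_basis] and [P.2] its family [J]. *)
Definition pattern_ok (R : realType) (F : finFieldType) (d k n : nat)
    (g : 'rV[F]_k -> R) (P : {set 'I_n} * {ffun 'I_n -> {set 'I_n}})
    (c : {ffun 'I_n -> 'rV[F]_k}) : bool :=
  (#|P.1| <= \rank (aff_span d P.1 c))%N &&
  [forall j, (j \notin P.1) ==>
     [&& P.2 j \subset P.1, (aff_lift d (c j) <= aff_span d (P.2 j) c)%MS
       & [forall i in P.2 j, g (c j) <= g (c i)]]].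

(** For fixed [A] the dependent points are summed over their flats first, at a cost of [2 q^k] each;
    only then are the independent points averaged over [A]. *)
Lemma pattern_bound (R : realType) (F : finFieldType) (d k : nat) (f : 'rV[F]_d -> R)
    (P : {set 'I_d.+1} * {ffun 'I_d.+1 -> {set 'I_d.+1}}) :
  (k < d)%N -> (forall x, 0 <= f x) ->
  \sum_x f x `^ (d.+1%:R / k.+1%:R) <= (#|F| ^ d)%:R ->
  \sum_(A : 'M[F]_(1 + d, d) | dsubmx A \in unitmx)
    \sum_(c | pattern_ok d (fun y : 'rV[F]_k => f (aff_lift d y *m A)) P c)
      \prod_i f (aff_lift d (c i) *m A)
  <= (2 ^ d.+1 * #|F| ^ (k * d.+1) * #|F| ^ ((1 + d) * d))%:R.
Proof.
case: P => I J kd f0 fp.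
(* An inconsistent pattern is met by no tuple, so its sum is empty. *)
have [/andP[Ik /forallP JI]|bad] :=
  boolP ((#|I| <= k.+1)%N && [forall j, (j \notin I) ==> (J j \subset I)]); last first.
  rewrite big1 ?ler0n // => A _; rewrite big_pred0 // => c.
  apply: contraNF bad => /andP[/= Ifree /forallP ok].
  rewrite (leq_trans Ifree (aff_span_rank_dim _ _ _)) /=.
  by apply/forallP => j; apply/implyP => jI; have := ok j; rewrite jI => /and3P[].
have {}JI j : j \notin I -> J j \subset I by apply/implyP.
set p : R := d.+1%:R / k.+1%:R in fp *.
pose g A (y : 'rV[F]_k) := f (aff_lift d y *m A).
pose N := (d.+1 - #|I|)%N.
(* Chosen so that an independent index lying in all [N] sets [J j] ends with the exponent
   [1 + N delta = p]. *)
pose delta : R := (p - 1) / N%:R.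
pose a i : R := if i \in I then 1 + #|[set j | (j \notin I) && (i \in J j)]|%:R * delta
                else 1 - #|J i|%:R * delta.
have N0 : (0 < N)%N by rewrite subn_gt0 (leq_ltn_trans Ik).
have NC : N = #|~: I| by rewrite cardsCs setCK card_ord.
have NR0 : 0 < N%:R :> R by rewrite ltr0n.
have NE : N%:R = d.+1%:R - #|I|%:R :> R by rewrite natrB // ltnW // (leq_ltn_trans Ik).
have pk : p * k.+1%:R = d.+1%:R by rewrite mulfVK // pnatr_eq0.
have p1 : 1 <= p by rewrite ler_pdivlMr // mul1r ler_nat ltnS ltnW.
have p0 : 0 < p by apply: lt_le_trans p1.
have delta0 : 0 <= delta by rewrite divr_ge0 ?ler0n // subr_ge0.
have dN : delta * N%:R = p - 1 by rewrite mulfVK // gt_eqF.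
have IkR : #|I|%:R <= k.+1%:R :> R by rewrite ler_nat.
have rI j : j \notin I -> #|J j|%:R <= #|I|%:R :> R.
  by move=> /JI JI'; rewrite ler_nat subset_leq_card.
(* As [delta * N = p - 1], the worst case [|I| delta <= 1] amounts to
   [|I| p <= d + 1 = p (k + 1)]. *)
have r1 j : j \notin I -> #|J j|%:R * delta <= 1.
  move=> jI; apply: le_trans (_ : #|I|%:R * delta <= 1).
    by rewrite ler_wpM2r // rI.
  rewrite -(ler_pM2r NR0) -mulrA dN mul1r NE mulrBr mulr1 lerD2r -pk mulrC.
  by rewrite ler_wpM2l // ltW.
have aI i : i \in I -> 0 <= a i <= p.
  move=> iI; rewrite /a iI (addr_ge0 ler01 (mulr_ge0 (ler0n _ _) delta0)) /=.
  rewrite -lerBrDl -dN mulrC ler_wpM2l // ler_nat NC.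
  by rewrite subset_leq_card //; apply/subsetP => j; rewrite !inE => /andP[].
have aJ j : j \notin I -> 0 <= a j <= p.
  move=> jI; rewrite /a (negPf jI) subr_ge0 r1 //= (le_trans _ p1) // gerBl.
  by rewrite mulr_ge0 ?ler0n.
have expo j : j \notin I -> #|J j|%:R - 1 + (d.+1%:R - #|J j|%:R) * a j / p <= k%:R.
  move=> jI; rewrite /a (negPf jI); set r : R := #|J j|%:R.
  have rI' : r <= #|I|%:R by rewrite rI.
  have r0 : 0 <= r by rewrite ler0n.
  (* [r <= #|I|] gives [delta >= (p - 1) / (d + 1 - r)]. *)
  have key : (d.+1%:R - r) * (1 - r * delta) <= d.+1%:R - r * p.
    have : r * delta * N%:R <= r * delta * (d.+1%:R - r).
      apply: ler_wpM2l; [exact: mulr_ge0 | by rewrite NE lerB].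
    by rewrite -mulrA dN; nra.
  rewrite -lerBrDl ler_pdivrMr //; apply: (le_trans key).
  by rewrite -pk -[k.+1]addn1 natrD; lra.
pose G := fun (A : 'M[F]_(1 + d, d)) (i : 'I_d.+1) (y : 'rV[F]_k) => g A y `^ a i.
have G0 : forall A i y, 0 <= G A i y by move=> *; rewrite /G powR_ge0.
(* Here [e] records the independent points, with 0 as filler off [I]. Given [e], each coordinate has
   its own range: a single point on [I], a flat off [I]. *)
pose Q (e : {ffun 'I_d.+1 -> 'rV[F]_k}) i : pred 'rV[F]_k :=
  if i \in I then pred1 (e i) else [pred y | (aff_lift d y <= aff_span d (J i) e)%MS].
pose E := [pred e : {ffun 'I_d.+1 -> 'rV[F]_k} |
  (e \in pffun_on 0 (mem I) predT) && (#|I| <= \rank (aff_span d I e))%N].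
pose phi (c : {ffun 'I_d.+1 -> 'rV[F]_k}) := [ffun i => if i \in I then c i else 0].
have spanphi c (S : {set 'I_d.+1}) : S \subset I -> aff_span d S (phi c) = aff_span d S c.
  by move=> SI; apply: eq_bigr => i /(subsetP SI) iI; rewrite ffunE iI.
(* Tuples are grouped by their restriction to [I]. The spans depend only on [e], so the constraints
   separate and the sum of products becomes a product of sums. *)
have step1 A : \sum_(c | pattern_ok d (g A) (I, J) c) \prod_i g A (c i) <=
    \sum_(e | E e) \prod_i \sum_(y | Q e i y) G A i y.
  rewrite (partition_big phi E) /=; last first.
    move=> c /andP[/= Ifree _]; rewrite spanphi // Ifree andbT.
    apply/pffun_onP; split=> //; apply/subsetP => i; rewrite inE ffunE.
    by case: ifP => // _; rewrite eqxx.
  apply: ler_sum => e _; rewrite bigA_distr_big_dep.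
  apply: le_trans (_ : \sum_(c | pattern_ok d (g A) (I, J) c && (phi c == e))
     \prod_i G A i (c i) <= _).
    apply: ler_sum => c /andP[/andP[/= _ /forallP ok] _].
    have := @prod_le_transfer _ _ I J (fun i => g A (c i)) delta delta0 (fun i => f0 _).
    have tr : forall j, j \notin I -> [/\ J j \subset I, #|J j|%:R * delta <= 1 &
                 {in J j, forall i, g A (c j) <= g A (c i)}].
      move=> j jI; have := ok j; rewrite jI /= => /and3P[_ _ /forall_inP gJ].
      by split; [apply: JI | apply: r1 | apply: gJ].
    move=> /(_ tr) /le_trans; apply.
    rewrite [leRHS](bigID (mem I)) /= le_eqVlt; apply/orP; left; apply/eqP.
    by congr (_ * _); apply: eq_bigr => i iI; rewrite /G /a ?iI ?(negPf iI).
  apply: ler_sum_subpred => [c|c]; last by rewrite prodr_ge0.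
  move=> /andP[/andP[/= _ /forallP ok] /eqP <-]; apply/familyP => i.
  rewrite /Q; case: ifPn => iI; rewrite !unfold_in; first by rewrite /= ffunE iI.
  by have := ok i; rewrite iI /= spanphi ?JI // => /and3P[].
have step2 A e : dsubmx A \in unitmx ->
    \prod_i \sum_(y | Q e i y) G A i y <=
    (2 * (#|F| ^ k)%:R) ^+ N * \prod_(i in I) G A i (e i).
  move=> Au; rewrite (bigID (mem I)) /= mulrC; apply: ler_pM.
  - by rewrite prodr_ge0 // => i _; rewrite sumr_ge0.
  - by rewrite prodr_ge0 // => i _; rewrite sumr_ge0.
  - rewrite NC -prodr_const [leRHS](eq_bigl (fun i => i \notin I)) => [|i]; last by rewrite inE.
    apply: ler_prod => i iI; rewrite sumr_ge0 //= /Q (negPf iI).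
    apply: (flat_sum_le (r := #|J i|) (p := p)) => //; rewrite ?aJ ?expo ?(ltnW kd) //.
      exact: aff_span_rank.
    by apply: aff_lift_mul_inj => //; apply: ltnW.
  - apply: ler_prod => i iI; rewrite sumr_ge0 //= /Q iI.
    by rewrite (big_pred1 (e i)).
(* Singular frames are let in, at no loss in the inequality since all terms are nonnegative; over
   all [A] the sum factorises by [sum_prod_free]. *)
apply: le_trans (_ : \sum_(A : 'M[F]_(1 + d, d)) \sum_(e | E e)
    (2 * (#|F| ^ k)%:R) ^+ N * \prod_(i in I) G A i (e i) <= _).
  apply: le_trans (_ : \sum_(A : 'M[F]_(1 + d, d) | dsubmx A \in unitmx) \sum_(e | E e)
    (2 * (#|F| ^ k)%:R) ^+ N * \prod_(i in I) G A i (e i) <= _).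
    apply: ler_sum => A Au; apply: (le_trans (step1 A)).
    by apply: ler_sum => e _; apply: step2.
  apply: ler_sum_subpred => // A; rewrite sumr_ge0 // => e _.
  by rewrite mulr_ge0 ?exprn_ge0 ?mulr_ge0 ?ler0n ?prodr_ge0.
rewrite exchange_big /=.
pose bound : R := (2 * (#|F| ^ k)%:R) ^+ N *
  ((#|F| ^ ((1 + d - #|I|) * d))%:R * (2 * (#|F| ^ d)%:R) ^+ #|I|).
apply: le_trans (_ : \sum_(e | E e) bound <= _).
  apply: ler_sum => e /andP[_ Ifree]; rewrite -mulr_sumr /bound.
  rewrite ler_wpM2l ?exprn_ge0 ?mulr_ge0 ?ler0n //.
  rewrite (sum_prod_free (fun i x => f x `^ a i) Ifree) ler_wpM2l ?ler0n //.
  rewrite -prodr_const; apply: ler_prod => i iI.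
  rewrite sumr_ge0 => [|x _]; last by rewrite powR_ge0.
  (* Threshold 1: small values contribute at most q^d, large ones at most the sum of f^p. *)
  apply: (le_trans (ler_sum _ (fun x _ => powR_le_split ltr01 (f0 x) (aI i iI)))).
  rewrite big_split /= -mulr_sumr !powR1 mul1r mulr_natl mulr2n lerD //.
  by rewrite sumr_const card_mx mul1n.
(* Forgetting the independence of [e] leaves q^(k |I|) choices. *)
apply: le_trans (_ : \sum_(e | e \in pffun_on 0 (mem I) (predT : pred 'rV[F]_k)) bound <= _).
  apply: ler_sum_subpred => [e /andP[]//|_].
  by rewrite !mulr_ge0 ?exprn_ge0 ?mulr_ge0 ?ler0n.
rewrite sumr_const card_pffun_on -[X in X <= _]mulr_natl /bound.
have -> : #|(predT : pred 'rV[F]_k)| = (#|F| ^ k)%N.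
  by rewrite -[k in RHS]mul1n -(card_mx F 1 k); apply: eq_card.
rewrite -!natrM -!natrX -!natrM ler_nat leq_eqVlt; apply/orP; left; apply/eqP.
rewrite [#|mem I|](_ : _ = #|I|); last exact: eq_card.
have arith q i m : d.+1 = (m + i)%N ->
    ((q ^ k) ^ i * ((2 * q ^ k) ^ m * (q ^ ((1 + d - i) * d) * (2 * q ^ d) ^ i)) =
     2 ^ d.+1 * q ^ (k * d.+1) * q ^ ((1 + d) * d))%N.
  rewrite add1n => ->; rewrite addnK !expnMn -!expnM !mulnDl !mulnDr !expnD.
  by rewrite [(d * i)%N]mulnC; ring.
by apply: arith; rewrite subnK // ltnW // (leq_ltn_trans Ik).
Qed.

(** * Summation over all patterns *)

Definition card_patterns (d : nat) : nat :=
  #|{: {set 'I_d.+1} * {ffun 'I_d.+1 -> {set 'I_d.+1}}}|.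

(** By [greedy_basis] every tuple in the expanded power fits at least one pattern, so summing over
    all patterns loses only [card_patterns d], which does not involve the field. *)
Lemma sum_affine_frames_le (R : realType) (F : finFieldType) (d k : nat)
    (f : 'rV[F]_d -> R) :
  (k < d)%N -> (forall x, 0 <= f x) ->
  \sum_x f x `^ (d.+1%:R / k.+1%:R) <= (#|F| ^ d)%:R ->
  \sum_(A : 'M[F]_(1 + d, d) | dsubmx A \in unitmx)
    (\sum_(y : 'rV[F]_k) f (aff_lift d y *m A)) ^+ d.+1
  <= (card_patterns d * (2 ^ d.+1 * #|F| ^ (k * d.+1) * #|F| ^ ((1 + d) * d)))%:R.
Proof.
move=> kd f0 fp; set B := (2 ^ d.+1 * _ * _)%N.
apply: le_trans (_ : \sum_(A : 'M[F]_(1 + d, d) | dsubmx A \in unitmx) \sum_P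
    \sum_(c | pattern_ok d (fun y : 'rV[F]_k => f (aff_lift d y *m A)) P c)
      \prod_(i < d.+1) f (aff_lift d (c i) *m A) <= _).
  apply: ler_sum => A _; pose g (y : 'rV[F]_k) := f (aff_lift d y *m A).
  rewrite -[d.+1 in X in X <= _]card_ord -prodr_const bigA_distr_bigA /=.
  rewrite (exchange_big_dep predT) //=; apply: ler_sum => c _.
  have prod0 : 0 <= \prod_i g (c i) by rewrite prodr_ge0 // => i _; apply: f0.
  rewrite sumr_const -/(g _); suff : (0 < #|[pred P | pattern_ok d g P c]|)%N.
    by move=> c0; rewrite -{1}[\prod_i g (c i)]mulr1n ler_wpMn2l.
  have [I [J [_ Ifree IJ]]] :=
    greedy_basis (fun i => aff_lift d (c i)) (fun i => g (c i)) [set: 'I_d.+1].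
  apply/card_gt0P; exists (I, J); rewrite inE /pattern_ok /= Ifree /=.
  apply/forallP => j; apply/implyP => jI.
  have [|JI eJ uJ] := IJ j; first by rewrite !inE jI.
  by rewrite JI /aff_span eJ; apply/forall_inP.
rewrite exchange_big /= natrM mulr_natl /card_patterns -sumr_const.
by apply: ler_sum => P _; apply: pattern_bound.
Qed.

(** * Affine frames as parameters of k-planes *)

Definition kplane_of (F : finFieldType) (d k : nat) (A : 'M[F]_(1 + d, d)) :
    {set 'rV[F]_d} :=
  [set aff_lift d y *m A | y : 'rV[F]_k].

Lemma kplane_ofP (F : finFieldType) (d k : nat) (w : {set 'rV[F]_d}) :
  (k <= d)%N ->
  is_kplane k w <->
  exists2 A : 'M[F]_(1 + d, d), dsubmx A \in unitmx & w = kplane_of k A.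
Proof.
move=> kd; split=> [[a [V [dimV ->]]]|[A Au ->]]; last first.
  pose h : {linear 'rV[F]_k -> 'rV[F]_d} := mulmxr (pid_mx k *m dsubmx A).
  have hE y : aff_lift d y *m A = usubmx A + h y by rewrite aff_lift_mulE /= mulmxA.
  pose V := limg (linfun h).
  exists (usubmx A), V; split.
    rewrite limg_dim_eq ?dimvf ?/dim /= ?mul1n //.
    apply/eqP; rewrite capfv; apply/lker0P => y z; rewrite !lfunE => yz.
    by apply: (aff_lift_mul_inj kd Au); rewrite !hE yz.
  apply/setP => x; apply/imsetP/imsetP => [[y _ ->]|[v /memv_imgP[y _ ->] ->]].
    exists (h y); last by rewrite hE.
    by apply/memv_imgP; exists y; rewrite ?memvf // lfunE.
  by exists y => //; rewrite hE lfunE.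
subst k; pose b := vbasis V.
pose M : 'M[F]_(\dim V, d) := \matrix_i b`_i.
have mulM (y : 'rV[F]_(\dim V)) : y *m M = \sum_i y 0 i *: b`_i.
  by rewrite mulmx_sum_row; apply: eq_bigr => i _; rewrite rowK.
have VM v : v \in V <-> exists y : 'rV[F]_(\dim V), v = y *m M.
  split=> [vV|[y ->]].
    exists (\row_i coord b i v); rewrite {1}(coord_vbasis vV) mulM.
    by apply: eq_bigr => i _; rewrite mxE.
  rewrite mulM rpred_sum // => i _; rewrite rpredZ // vbasis_mem // mem_nth //.
  by rewrite size_tuple.
have Mfree : row_free M.
  apply: inj_row_free => y; rewrite mulM => y0.
  apply/rowP => i; rewrite mxE.
  exact: (elimT freeP (basis_free (vbasisP V)) (y 0) y0 i).
have rM : \rank M = \dim V by apply/eqP.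
(* In the factorisation [ME] below, [col_ebase M] only changes the basis, so the first [\dim V] rows
   of the invertible [U] span [V]. *)
pose U := row_ebase M.
exists (col_mx a U); first by rewrite col_mxKd row_ebase_unit.
have ME : M = col_ebase M *m pid_mx (\dim V) *m U by have := mulmx_ebase M; rewrite rM => ->.
apply/setP => x; apply/imsetP/imsetP => [[v /VM[y ->] ->]|[y _ ->]].
  exists (y *m col_ebase M) => //.
  by rewrite aff_lift_mulE col_mxKu col_mxKd {1}ME !mulmxA.
exists (y *m invmx (col_ebase M) *m M); first by apply/VM; eexists.
rewrite aff_lift_mulE col_mxKu col_mxKd {2}ME !mulmxA mulmxKV //.
exact: col_ebase_unit.
Qed.

(* The affine group acts on the right, transitively on frames and on planes, so
   the fibres of [kplane_of k] all have the same size. *)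
Lemma kplane_of_fibre_le (F : finFieldType) (d k : nat) (A1 A2 : 'M[F]_(1 + d, d)) :
  dsubmx A1 \in unitmx -> dsubmx A2 \in unitmx ->
  (#|[set A : 'M[F]_(1 + d, d) |
        (dsubmx A \in unitmx) && (kplane_of k A == kplane_of k A1)]|
  <= #|[set A : 'M[F]_(1 + d, d) |
         (dsubmx A \in unitmx) && (kplane_of k A == kplane_of k A2)]|)%N.
Proof.
move=> A1u A2u; set X1 := [set A | _]; set X2 := [set A | _].
(* [act] moves frames by the affine map [x |-> (x - usubmx A1) M + usubmx A2], with [M] chosen so
   that [A1] goes to [A2]. *)
pose M := invmx (dsubmx A1) *m dsubmx A2.
have Mu : M \in unitmx by rewrite unitmx_mul unitmx_inv A1u A2u.
pose act (A : 'M[F]_(1 + d, d)) : 'M[F]_(1 + d, d) :=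
  col_mx ((usubmx A - usubmx A1) *m M + usubmx A2) (dsubmx A *m M).
have planeE A : kplane_of k (act A) =
    [set (x - usubmx A1) *m M + usubmx A2 | x in kplane_of k A].
  rewrite -imset_comp; apply: eq_imset => y /=.
  rewrite !aff_lift_mulE /act col_mxKu col_mxKd !mulmxBl mulmxDl !mulmxA.
  by rewrite addrAC; congr (_ + _); rewrite addrAC.
have actA1 : act A1 = A2.
  by rewrite /act subrr mul0mx add0r /M mulmxA mulmxV // mul1mx vsubmxK.
rewrite -(card_imset (f := act)).
  apply/subset_leq_card/subsetP => B /imsetP[A]; rewrite !inE => /andP[Au /eqP AA1] ->.
  by rewrite col_mxKd unitmx_mul Au Mu /= planeE AA1 -planeE actA1.
move=> A B /eq_col_mx[/addIr/(congr1 (mulmx^~ (invmx M))) /= u /(congr1 (mulmx^~ (invmx M))) /= l].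
move: u l; rewrite !mulmxK // => /addIr u l.
by rewrite -[A]vsubmxK -[B]vsubmxK u l.
Qed.

(** Equal fibres make the average over frames equal to the average over k-planes; the identity is
    cross-multiplied to avoid division. *)
Lemma sum_kplane (R : realType) (F : finFieldType) (d k : nat)
    (G : {set 'rV[F]_d} -> R) :
  (k <= d)%N ->
  #|{: kplane F d k}|%:R * \sum_(A : 'M[F]_(1 + d, d) | dsubmx A \in unitmx) G (kplane_of k A) =
  #|[set A : 'M[F]_(1 + d, d) | dsubmx A \in unitmx]|%:R * \sum_(w : kplane F d k) G (val w).
Proof.
move=> kd.
have kpl (A : 'M[F]_(1 + d, d)) : dsubmx A \in unitmx -> `[< is_kplane k (kplane_of k A) >].
  by move=> Au; apply/asboolP/kplane_ofP => //; exists A.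
pose A0 : 'M[F]_(1 + d, d) := col_mx 0 1%:M.
have A0u : dsubmx A0 \in unitmx by rewrite col_mxKd unitmx1.
(* A coordinate plane through the origin serves as default for [insubd]; [plE] identifies [pl A]
   when the linear part is invertible. *)
pose w0 : kplane F d k := exist (fun w => is_true `[< is_kplane k w >]) _ (kpl _ A0u).
pose pl A : kplane F d k := insubd w0 (kplane_of k A).
have plE A : dsubmx A \in unitmx -> val (pl A) = kplane_of k A.
  by move=> Au; rewrite insubdK //; exact: (kpl A Au).
pose K := #|[set A : 'M[F]_(1 + d, d) |
  (dsubmx A \in unitmx) && (kplane_of k A == kplane_of k A0)]|.
have fibre (w : kplane F d k) :
    #|[set A : 'M[F]_(1 + d, d) | (dsubmx A \in unitmx) && (pl A == w)]| = K.
  have /asboolP/(kplane_ofP _ kd)[A Au wA] := valP w.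
  transitivity #|[set B : 'M[F]_(1 + d, d) |
    (dsubmx B \in unitmx) && (kplane_of k B == kplane_of k A)]|.
    apply: eq_card => B; rewrite !inE; apply: andb_id2l => Bu.
    by rewrite -val_eqE plE // wA.
  by apply/eqP; rewrite eqn_leq !kplane_of_fibre_le.
have sumE (H : {set 'rV[F]_d} -> R) :
    \sum_(A : 'M[F]_(1 + d, d) | dsubmx A \in unitmx) H (kplane_of k A) =
    K%:R * \sum_(w : kplane F d k) H (val w).
  rewrite (partition_big pl predT) //= mulr_sumr; apply: eq_bigr => w _.
  rewrite (eq_bigr (fun=> H (val w))) => [|A /andP[Au /eqP <-]]; last by rewrite plE.
  rewrite sumr_const -[LHS]mulr_natl -(fibre w); congr (_%:R * _).
  by apply: eq_card => A; rewrite !inE.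
have cardE : #|[set A : 'M[F]_(1 + d, d) | dsubmx A \in unitmx]|%:R =
    K%:R * #|{: kplane F d k}|%:R :> R.
  have /= := sumE (fun=> 1); rewrite [in RHS]sumr_const => <-; rewrite -sumr_const.
  by apply: eq_bigl => A; rewrite inE.
by rewrite sumE cardE mulrA [_ * K%:R]mulrC.
Qed.

(** * The share of invertible frames *)

(** The factor after [2 ^ n] is the order of GL_n over a field of [q] elements. Each [q ^ i] is at
    most [2 (q ^ i - 1)], and the exponents add up to [n * n]. *)
Lemma expn_sqr_le_card_GL (q n : nat) :
  (1 < q)%N ->
  (q ^ (n * n) <= 2 ^ n * (q ^ 'C(n, 2) * \prod_(1 <= i < n.+1) (q ^ i - 1)))%N.
Proof.
move=> q1; elim: n => [|n IH]; first by rewrite big_nil.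
rewrite big_nat_recr //= binS bin1.
have -> : (n.+1 * n.+1 = n * n + (n + n.+1))%N by lia.
have qn : (q ^ n.+1 <= 2 * (q ^ n.+1 - 1))%N.
  have : (1 < q ^ n.+1)%N by rewrite -[1%N](exp1n n.+1) ltn_exp2r.
  by lia.
apply: leq_trans (_ : q ^ (n * n) * (q ^ n * (2 * (q ^ n.+1 - 1))) <= _)%N.
  by rewrite !expnD !leq_mul.
apply: leq_trans (leq_mul IH (leqnn _)) _.
by rewrite expnD [(2 ^ n.+1)%N]expnS leq_eqVlt; apply/orP; left; apply/eqP; lia.
Qed.

(** A frame is a translation row above an invertible matrix, so the order of GL_d decides. *)
Lemma card_affine_frames_ge (F : finFieldType) (d : nat) :
  (0 < d)%N ->
  (#|F| ^ ((1 + d) * d) <=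
    2 ^ d * #|[set A : 'M[F]_(1 + d, d) | dsubmx A \in unitmx]|)%N.
Proof.
case: d => // d _.
pose phi (u : 'rV[F]_d.+1 * {unit 'M[F]_d.+1}) : 'M[F]_(1 + d.+1, d.+1) :=
  col_mx u.1 (FinRing.uval u.2).
have phi_inj : injective phi.
  by move=> [a U] [b V] /eq_col_mx[/= -> /val_inj ->].
apply: leq_trans (_ : 2 ^ d.+1 * #|[set phi u | u : 'rV[F]_d.+1 * {unit 'M[F]_d.+1}]| <= _)%N.
  rewrite card_imset // card_prod card_mx mulnDl expnD mulnCA leq_mul2l; apply/orP; right.
  apply: leq_trans (expn_sqr_le_card_GL d.+1 (card_finNzRing_gt1 F)) _.
  by rewrite -card_GL // cardsT.
rewrite leq_mul2l subset_leq_card ?orbT //; apply/subsetP => A /imsetP[[a U] _ ->].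
by rewrite inE col_mxKd; exact: (valP U).
Qed.

(** * From frames back to averages over k-planes *)

Lemma kplane_average_le (R : realType) (F : finFieldType) (d k : nat)
    (f : 'rV[F]_d -> R) :
  (k < d)%N -> (forall x, 0 <= f x) ->
  \sum_x f x `^ (d.+1%:R / k.+1%:R) <= (#|F| ^ d)%:R ->
  #|{: kplane F d k}|%:R^-1 *
    \sum_(w : kplane F d k) (#|val w|%:R^-1 * \sum_(x in val w) f x) ^+ d.+1
  <= (card_patterns d * 2 ^ d.+1 * 2 ^ d)%:R.
Proof.
move=> kd f0 fp; have kd' := ltnW kd.
have [->|M0] := eqVneq (#|{: kplane F d k}|%:R : R) 0.
  by rewrite invr0 mul0r ler0n.
have MR0 : 0 < #|{: kplane F d k}|%:R :> R by rewrite lt0r M0 ler0n.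
pose avg (w : {set 'rV[F]_d}) : R := (#|w|%:R^-1 * \sum_(x in w) f x) ^+ d.+1.
have q0 m : 0 < (#|F| ^ m)%:R :> R.
  by rewrite ltr0n expn_gt0; apply/orP; left; apply/card_gt0P; exists 0.
have avgE (A : 'M[F]_(1 + d, d)) : dsubmx A \in unitmx ->
    avg (kplane_of k A) =
    (#|F| ^ (k * d.+1))%:R^-1 * (\sum_(y : 'rV[F]_k) f (aff_lift d y *m A)) ^+ d.+1.
  move=> Au; have Ainj := aff_lift_mul_inj kd' Au.
  rewrite /avg /kplane_of card_imset // card_mx mul1n exprMn exprVn -natrX -expnM.
  by rewrite big_imset //= => y z _ _; apply: Ainj.
have := sum_kplane avg kd'; set good := #|_|.
rewrite (eq_bigr _ avgE) -mulr_sumr => sumE.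
have core := sum_affine_frames_le kd f0 fp.
have frames : (#|F| ^ ((1 + d) * d))%:R <= (2 ^ d)%:R * good%:R :> R.
  by rewrite -natrM ler_nat card_affine_frames_ge // (leq_ltn_trans _ kd).
have good0 : 0 < good%:R :> R.
  by have := lt_le_trans (q0 _) frames; rewrite pmulr_rgt0 // ltr0n expn_gt0.
rewrite ler_pdivrMl // -(ler_pM2l good0) -[X in _ * X <= _]/(\sum_w avg (val w)) -sumE.
rewrite [leRHS]mulrCA ler_pM2l // ler_pdivrMl //; apply: (le_trans core).
(* [Q] comes from the sizes of the planes, and the remaining power of [#|F|] is absorbed by the
   number of invertible frames, so no power of q survives. *)
rewrite !natrM; set Q : R := (#|F| ^ (k * d.+1))%:R.
have Q0 : 0 < Q by apply: q0.
move: frames; set X : R := (#|F| ^ _)%:R => frames.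
rewrite [leRHS](_ : _ =
  (card_patterns d)%:R * ((2 ^ d.+1)%:R * Q * ((2 ^ d)%:R * good%:R))); last by ring.
by rewrite !ler_wpM2l ?mulr_ge0 ?ler0n // ltW.
Qed.

(** * Reduction of the product to single nonnegative functions *)

(** Every factor is at most the largest one, whose power is among the summands. *)
Lemma prod_le_sum_expr (R : realDomainType) (n : nat) (a : 'I_n.+1 -> R) :
  (forall i, 0 <= a i) -> \prod_i a i <= \sum_i a i ^+ n.+1.
Proof.
move=> a0; pose m := [arg max_(i > ord0) a i]%O.
have am i : a i <= a m by rewrite /m; case: arg_maxP => // j _; apply.
apply: le_trans (_ : a m ^+ n.+1 <= _).
  rewrite -[n.+1 in leRHS]card_ord -prodr_const; apply: ler_prod => i _.
  by rewrite a0 am.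
by rewrite (bigD1 m) //= lerDl sumr_ge0 // => i _; rewrite exprn_ge0.
Qed.

Local Notation normc := ComplexField.Normc.normc.

Lemma normc_ge0 (R : rcfType) (z : R[i]) : 0 <= normc z.
Proof. by case: z => x y; rewrite /normc sqrtr_ge0. Qed.

Lemma normc_prod (R : rcfType) (T : finType) (z : T -> R[i]) :
  normc (\prod_i z i) = \prod_i normc (z i).
Proof.
exact: (big_morph _ (@ComplexField.Normc.normcM R) (ComplexField.Normc.normc1 R)).
Qed.

Lemma normc_sum_le (R : rcfType) (T : finType) (P : pred T) (z : T -> R[i]) :
  normc (\sum_(i | P i) z i) <= \sum_(i | P i) normc (z i).
Proof.
elim/big_ind2: _ => [|x a y b xa yb|//]; first by rewrite ComplexField.Normc.normc0.
by apply: le_trans (lerD xa yb); exact: le_normcD.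
Qed.

Lemma normc_nat (R : rcfType) (n : nat) : normc (n%:R : R[i]) = n%:R.
Proof. by rewrite (normcMn (1 : Rcomplex R)) ComplexField.Normc.normc1. Qed.

Lemma normc_kplane_transform_le (R : realType) (F : finFieldType) (d k : nat)
    (f : 'rV[F]_d -> R[i]) (w : kplane F d k) :
  normc (kplane_transform f w) <= #|val w|%:R^-1 * \sum_(x in val w) normc (f x).
Proof.
rewrite /kplane_transform ComplexField.Normc.normcM ComplexField.Normc.normcV normc_nat.
by rewrite ler_wpM2l ?invr_ge0 ?ler0n // normc_sum_le.
Qed.

Theorem corollary1p3 (R : realType) (d k : nat)
    (hd : (2 <= d)%N) (hk : (1 <= k <= d.-1)%N) :
  exists2 C : R, 0 < C &
    forall (F : finFieldType) (f : 'I_d.+1 -> 'rV[F]_d -> R[i]),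
      normalized_Lp_norm 1
        (fun w : kplane F d k => \prod_(j < d.+1) kplane_transform (f j) w)
      <= C * \prod_(j < d.+1)
               normalized_Lp_norm (d.+1%:R / k.+1%:R) (f j).
Proof.
have kd : (k < d)%N by lia.
(* [K] bounds the average for one normalised function; the factor [d + 1] pays for the sum over
   [j]. *)
pose K : R := (card_patterns d * 2 ^ d.+1 * 2 ^ d)%:R.
exists (d.+1%:R * K).
  rewrite mulr_gt0 ?ltr0n // !muln_gt0 !expn_gt0 /= !andbT.
  by apply/card_gt0P; exists (set0, [ffun=> set0]).
move=> F f; set p : R := d.+1%:R / k.+1%:R.
have p0 : 0 < p by rewrite divr_gt0 ?ltr0n.
have q0 : 0 < (#|F| ^ d)%:R :> R.
  by rewrite ltr0n expn_gt0; apply/orP; left; apply/card_gt0P; exists 0.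
pose S j : R := \sum_x normc (f j x) `^ p.
have S0 j : 0 <= S j by rewrite sumr_ge0 // => x _; apply: powR_ge0.
pose L j : R := normalized_Lp_norm p (f j).
have LE j : L j = ((#|F| ^ d)%:R^-1 * S j) `^ p^-1.
  by rewrite /L /normalized_Lp_norm card_mx mul1n.
have L0 j : 0 <= L j by rewrite LE powR_ge0.
have Lp j : L j `^ p = (#|F| ^ d)%:R^-1 * S j.
  by rewrite LE -powRrM mulVf ?gt_eqF // powRr1 // mulr_ge0 // invr_ge0 ltW.
rewrite /normalized_Lp_norm invr1 powRr1; last first.
  by rewrite mulr_ge0 ?invr_ge0 ?ler0n // sumr_ge0 // => w _; apply: powR_ge0.
under eq_bigr => w _ do rewrite powRr1 ?normc_ge0 // normc_prod.
rewrite -[X in _ <= _ * X]/(\prod_j L j).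
have K0 : 0 <= K by rewrite ler0n.
(* A zero norm forces that [f j] to vanish, and with it the left side; otherwise every norm can be
   divided out. *)
have [/existsP[j /eqP Lj]|/existsPn Lneq] := boolP [exists j, L j == 0].
  have fj x : f j x = 0.
    have := Lp j; rewrite Lj powR0 ?gt_eqF // => /esym/eqP.
    rewrite mulf_eq0 invr_eq0 gt_eqF //= psumr_eq0 => [|y _]; last exact: powR_ge0.
    by move=> /allP/(_ x (mem_index_enum x))/eqP/powR_eq0_eq0/ComplexField.Normc.eq0_normc.
  rewrite big1 ?mulr0 ?mulr_ge0 ?ler0n ?prodr_ge0 // => w _.
  rewrite (bigD1 j) //= /kplane_transform big1 => [|x _]; last exact: fj.
  by rewrite mulr0 ComplexField.Normc.normc0 mul0r.
have Lgt0 j : 0 < L j by rewrite lt0r Lneq L0.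
pose u j x := normc (f j x) / L j.
have u0 j x : 0 <= u j x by rewrite divr_ge0 ?normc_ge0.
have up j : \sum_x u j x `^ p <= (#|F| ^ d)%:R.
  rewrite (eq_bigr (fun x => normc (f j x) `^ p / L j `^ p)) => [|x _]; last first.
    by rewrite /u powRM ?normc_ge0 ?invr_ge0 // -[_^-1]powR_inv1 // powRAC powR_inv1 ?powR_ge0.
  rewrite -mulr_suml -/(S j) ler_pdivrMr; last exact: powR_gt0.
  rewrite Lp mulrA divff ?mul1r //.
  by rewrite gt_eqF.
pose a j (w : kplane F d k) : R := #|val w|%:R^-1 * \sum_(x in val w) u j x.
have a0 j w : 0 <= a j w by rewrite mulr_ge0 ?invr_ge0 ?ler0n // sumr_ge0.
(* By homogeneity the norms come out, and the product of averages gives way to the sum of their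
   powers. *)
apply: le_trans (_ : #|{: kplane F d k}|%:R^-1 *
    \sum_(w : kplane F d k) (\prod_j L j) * \sum_j a j w ^+ d.+1 <= _).
  rewrite ler_wpM2l ?invr_ge0 ?ler0n //; apply: ler_sum => w _.
  apply: le_trans (_ : (\prod_j L j) * \prod_j a j w <= _); last first.
    by rewrite ler_wpM2l ?prodr_ge0 // prod_le_sum_expr.
  rewrite -big_split /=; apply: ler_prod => j _; rewrite normc_ge0 /=.
  apply: (le_trans (normc_kplane_transform_le _ _)).
  rewrite le_eqVlt; apply/orP; left; apply/eqP; rewrite /a mulrCA; congr (_ * _).
  by rewrite mulr_sumr; apply: eq_bigr => x _; rewrite /u mulrC divfK // Lneq.
rewrite -mulr_sumr mulrCA [leRHS]mulrC ler_wpM2l ?prodr_ge0 //.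
have -> : d.+1%:R * K = \sum_(j < d.+1) K by rewrite sumr_const card_ord mulr_natl.
rewrite exchange_big /= mulr_sumr.
by apply: ler_sum => j _; apply: kplane_average_le.
Qed.
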